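(* Let $N\geqslant 1$. There is a dense $G_\delta$ subset $\mathcal Z$ of $\mathcal C(\mathbb R^N)$ such that $\dim p_L X=0$ for each $X\in\mathcal Z$ and each linear subspace $L\subset\mathbb R^N$.
   Context: A Cantor set is any topological space homeomorphic to the standard middle-thirds Cantor set. $\mathcal C(\mathbb R^N)$ is the set of all subsets of $\mathbb R^N$ that are Cantor sets, endowed with the Hausdorff metric $d_H(X,Y)=\inf\{\varepsilon>0 \mid X\subset O(Y,\varepsilon),\ Y\subset O(X,\varepsilon)\}$, where $O(X,\varepsilon)=\{y\in\mathbb R^N\mid d(y,X)<\varepsilon\}$ and $d$ is the Euclidean distance. For a linear subspace $L\subset\mathbb R^N$, $p_L$ is the orthogonal projection of $\mathbb R^N$ into $L$, and $p_L X$ is the image of $X$. $\dim$ is topological dimension; a non-empty compact metrizable space has dimension $0$ iff it has a base of clopen sets (equivalently, iff it is totally disconnected). *)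

(* Defs.v *)
From HB Require Import structures.
From mathcomp Require Import all_boot all_order all_algebra.
From mathcomp Require Import all_classical all_reals all_analysis.
From mathcomp Require Import ring lra.

Set Implicit Arguments.
Unset Strict Implicit.
Unset Printing Implicit Defensive.

Import Order.TTheory GRing.Theory Num.Theory.
Import numFieldNormedType.Exports.

Local Open Scope classical_set_scope.
Local Open Scope ring_scope.

Definition homeomorphic (S T : topologicalType) : Prop :=
  exists (f : S -> T) (g : T -> S),
    [/\ continuous f, continuous g, cancel f g & cancel g f].

(* The small inductive dimension, shifted by one so that the empty space, of
   dimension -1, gets index 0: [ind_le n T] says that T has dimension at most
   n - 1. For open V the set closure V `\` V is the boundary of V, and
   [set_type] carries the subspace topology. On separable metrizable spaces this
   is the covering dimension. *)
Fixpoint ind_le (n : nat) (T : topologicalType) : Prop :=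
  if n is m.+1 then
    forall (x : T) (W : set T), open W -> W x ->
      exists V : set T, [/\ open V, V x, V `<=` W &
        ind_le m (set_type (closure V `\` V))]
  else [set: T] = set0.

Definition has_dim (T : topologicalType) (n : nat) : Prop :=
  ind_le n.+1 T /\ ~ ind_le n T.

Lemma has_dim0P (T : topologicalType) :
  has_dim T 0 <-> [set: T] !=set0 /\
    forall (x : T) (W : set T), open W -> W x ->
      exists V : set T, [/\ clopen V, V x & V `<=` W].
Proof.
have bdE (V : set T) : open V ->
    [set: set_type (closure V `\` V)] = set0 <-> clopen V.
  move=> oV; split=> [b0|[_ cV]].
    split=> //; apply/closure_id/seteqP; split=> [|x clVx]; first exact: subset_closure.
    apply: contrapT => Vx.
    have bx : x \in closure V `\` V by rewrite inE.
    by suff : [set: set_type (closure V `\` V)] (SigSub bx) by rewrite b0.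
  rewrite -subset0 => -[x bx] _; have [clVx Vx] := set_mem bx.
  by apply: Vx; rewrite (closure_id V).1.
split=> [[le1 /eqP/set0P T0]|[T0 base]].
  split=> // x W oW Wx; have [V [oV Vx VW /bdE cV]] := le1 x W oW Wx.
  by exists V; split=> //; exact: cV.
split=> [x W oW Wx|]; last by apply/eqP/set0P.
have [V [cV Vx VW]] := base x W oW Wx.
by exists V; split=> //; [exact: cV.1|apply/(bdE _ cV.1)].
Qed.

Section MiddleThirds.
Context {R : realType}.

Fixpoint ternary_stage (n : nat) : set R :=
  if n is m.+1 then
    [set x / 3 | x in ternary_stage m] `|` [set (x + 2) / 3 | x in ternary_stage m]
  else `[0, 1].

Definition middle_thirds : set R := \bigcap_n ternary_stage n.

Lemma middle_thirds0 : middle_thirds 0.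
Proof.
move=> n _; elim: n => [|n IH] /=; first by rewrite in_itv/= lexx ler01.
by left; exists 0; rewrite ?mul0r.
Qed.

Lemma compact_middle_thirds : compact middle_thirds.
Proof.
have cst n : compact (ternary_stage n).
  elim: n => [|n IH] /=; first exact: segment_compact.
  apply: compactU; apply: continuous_compact => //; apply: continuous_subspaceT.
    by move=> x; exact: cvgMl.
  by move=> x; apply: cvgMl; apply: cvgD; [exact: cvg_id|exact: cvg_cst].
apply: (@subclosed_compact _ _ (ternary_stage 0)) => //.
  apply: closed_bigI => n _; apply: compact_closed (cst n).
  exact: norm_hausdorff.
by apply: bigcap_inf.
Qed.

End MiddleThirds.
Arguments middle_thirds : clear implicits.

Definition is_cantor (R : realType) (T : topologicalType) : Prop :=
  homeomorphic T (set_type (middle_thirds R)).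

Section Euclid.
Context {R : realType} {N : nat}.
Implicit Types (x y z : 'rV[R]_N) (X Y Z : set 'rV[R]_N) (L : {vspace 'rV[R]_N}).

Definition dotv x y : R := \sum_(i < N) x 0 i * y 0 i.

Lemma dotv_bilinear :
  bilinear_for (GRing.Scale.Law.clone _ _ *%R _)
    (GRing.Scale.Law.clone _ _ (idfun \; *%R) _) dotv.
Proof.
split=> [y|x] a u v; rewrite /dotv /= mulr_sumr -big_split; apply: eq_bigr => i _;
  by rewrite !mxE ?mulrDl ?mulrDr -?mulrA 1?(mulrCA a).
Qed.

HB.instance Definition _ := bilinear_isBilinear.Build R _ _ _ _ _ dotv dotv_bilinear.

Lemma dotv_hermitian x y : dotv x y = (-1) ^+ false * idfun (dotv y x).
Proof. by rewrite expr0 mul1r; apply: eq_bigr => i _; rewrite mulrC. Qed.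

HB.instance Definition _ :=
  isHermitianSesquilinear.Build R _ false idfun dotv dotv_hermitian.

Lemma dotv_gt0 x : x != 0 -> 0 < dotv x x.
Proof.
apply: contraNT; rewrite -leNgt => x0; apply/eqP/rowP => i; rewrite mxE.
have : dotv x x == 0.
  by rewrite eq_le x0 sumr_ge0// => j _; rewrite -expr2 sqr_ge0.
rewrite psumr_eq0 => [/allP/(_ i)|j _]; last by rewrite -expr2 sqr_ge0.
by rewrite mem_index_enum -expr2 sqrf_eq0 => /(_ isT)/eqP.
Qed.

HB.instance Definition _ := isDotProduct.Build R _ dotv dotv_gt0.

Definition ortho_proj L : 'End('rV[R]_N) := daddv_pi L (orthov dotv L).

Lemma capv_orthov L : (L :&: orthov dotv L = 0)%VS.
Proof.
apply/eqP; rewrite -subv0; apply/subvP => u; rewrite memv_cap memv0.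
case/andP => uL /mem_orthovP/(_ _ uL) u0; apply: contraTT isT => /dotv_gt0.
by rewrite u0 ltxx.
Qed.

Lemma addv_orthov L : (L + orthov dotv L = fullv)%VS.
Proof.
have dimo (s : seq 'rV[R]_N) : (\dim {:'rV[R]_N} <= \dim (orthov dotv << s >>) + size s)%N.
  elim: s => [|u s IH]; first by rewrite span_nil orthov0 addn0.
  rewrite span_cons addnS.
  have -> : (orthov dotv (<[u]> + << s >>) = orthov dotv << s >> :&: orthov dotv <[u]>)%VS.
    apply/eqP; rewrite eqEsubv subv_cap.
    have := subvv (orthov dotv (<[u]> + << s >>)%VS); rewrite orthovD => /andP[-> ->].
    by rewrite orthovD capvSl capvSr.
  apply: leq_trans IH _; rewrite -addSn leq_add2r.
  rewrite (leq_trans (leqSpred _))// ltnS.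
  exact: (leq_dim_orthov1 dotv u (orthov dotv << s >>)).
apply/eqP; rewrite eqEdim subvf dimv_disjoint_sum ?capv_orthov// addnC.
by have := dimo (vbasis L); rewrite size_tuple (span_basis (vbasisP L)).
Qed.

Lemma ortho_proj_mem L x : ortho_proj L x \in L.
Proof. exact: memv_pi. Qed.

Lemma ortho_projP L x : {in L, forall y, dotv (x - ortho_proj L x) y = 0}.
Proof.
apply/mem_orthovP.
rewrite -{1}(@daddv_pi_add _ _ L (orthov dotv L) x) ?capv_orthov ?addv_orthov ?memvf//.
by rewrite addrAC subrr add0r memv_pi.
Qed.

(* The norm that the library puts on row vectors is the sup norm; it induces the
   same topology as the Euclidean distance. *)
Definition edistv x y : R := Num.sqrt (dotv (x - y) (x - y)).

Definition edist_set y X : R := inf [set edistv y x | x in X].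

Definition onbhd X (e : R) : set 'rV[R]_N := [set y | edist_set y X < e].

Definition hausdorff_dist X Y : R :=
  inf [set e | [/\ 0 < e, X `<=` onbhd Y e & Y `<=` onbhd X e]].

Lemma dotvv_ge0 x : 0 <= dotv x x.
Proof. by apply: sumr_ge0 => i _; rewrite -expr2 sqr_ge0. Qed.

Lemma dotvC x y : dotv x y = dotv y x.
Proof. by apply: eq_bigr => i _; rewrite mulrC. Qed.

Lemma dotv_CS x y : dotv x y ^+ 2 <= dotv x x * dotv y y.
Proof.
have [->|y0] := eqVneq y 0.
  have -> : dotv x 0 = 0 by apply: big1 => i _; rewrite mxE mulr0.
  by rewrite expr0n /= mulr_ge0// dotvv_ge0.
have d0 := dotv_gt0 y0.
rewrite -subr_ge0 -(pmulr_rge0 _ d0).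
have -> : dotv y y * (dotv x x * dotv y y - dotv x y ^+ 2) =
    dotv (dotv y y *: x - dotv x y *: y) (dotv y y *: x - dotv x y *: y).
  rewrite linearBl !linearB/= !linearZl_LR /= !linearZr/= (dotvC y x) /GRing.scale/=; ring.
exact: dotvv_ge0.
Qed.

Lemma edistv_ge0 x y : 0 <= edistv x y.
Proof. exact: sqrtr_ge0. Qed.

Lemma edistvxx x : edistv x x = 0.
Proof. by rewrite /edistv subrr [dotv _ _]big1 ?sqrtr0// => i _; rewrite mxE mulr0. Qed.

Lemma edistvC x y : edistv x y = edistv y x.
Proof.
by congr Num.sqrt; apply: eq_bigr => i _; rewrite !mxE -!expr2 -sqrrN opprB.
Qed.

Lemma edistv_triangle y x z : edistv x z <= edistv x y + edistv y z.
Proof.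
rewrite -(ger0_norm (addr_ge0 (edistv_ge0 x y) (edistv_ge0 y z))) -sqrtr_sqr.
rewrite ler_wsqrtr// sqrrD !sqr_sqrtr ?dotvv_ge0//.
rewrite /edistv; have -> : x - z = (x - y) + (y - z) by rewrite addrA subrK.
move: (x - y) (y - z) => u v.
rewrite linearDl/= !linearDr/= (dotvC v u).
have uv : dotv u v <= Num.sqrt (dotv u u) * Num.sqrt (dotv v v).
  by rewrite -sqrtrM ?dotvv_ge0// (le_trans (ler_norm _))// -sqrtr_sqr ler_wsqrtr ?dotv_CS.
rewrite mulr2n; lra.
Qed.

Lemma edistv_ball x y e : edistv x y < e -> ball x e y.
Proof.
move=> xye; split=> [|i j]; first exact: le_lt_trans (edistv_ge0 x y) xye.
apply: le_lt_trans xye.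
rewrite ord1 -sqrtr_sqr ler_wsqrtr// /dotv (bigD1 j)//= !mxE -expr2 lerDl.
by apply: sumr_ge0 => k _; rewrite -expr2 sqr_ge0.
Qed.

Lemma edistv_le_norm x y : edistv x y <= Num.sqrt (N%:R * `|x - y| ^+ 2).
Proof.
apply: ler_wsqrtr.
have -> : N%:R * `|x - y| ^+ 2 = \sum_(i < N) `|x - y| ^+ 2.
  by rewrite sumr_const card_ord mulr_natl.
apply: ler_sum => i _; rewrite -expr2 -[_ ^+ 2]real_normK ?num_real//.
rewrite lerXn2r ?nnegrE// [leRHS]/Num.Def.normr/= mx_normrE.
exact: (le_bigmax _ _ (0, i)).
Qed.

Lemma onbhdP X e y : X !=set0 ->
  onbhd X e y <-> exists2 x, X x & edistv y x < e.
Proof.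
move=> [x0 Xx0]; split=> [|[x Xx xe]].
  by move=> /inf_lt[]; [exists (edistv y x0), x0|move=> _ [x Xx <-]; exists x].
apply: le_lt_trans xe; apply: ge_inf; last by exists x.
by exists 0 => _ [z _ <-]; exact: edistv_ge0.
Qed.

Lemma compact_onbhd X Y : compact X -> Y !=set0 -> exists2 e, 0 < e & X `<=` onbhd Y e.
Proof.
move=> /compact_bounded [M [_ XM]] [y Yy].
pose K := `|M| + 1 + `|y|.
exists (Num.sqrt (N%:R * K ^+ 2) + 1); first by rewrite ltr_wpDl// sqrtr_ge0.
move=> x Xx; apply/onbhdP; first by exists y.
exists y => //; rewrite ltr_pwDr// (le_trans (edistv_le_norm _ _))//.
rewrite ler_wsqrtr// ler_wpM2l// lerXn2r ?nnegrE ?addr_ge0//.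
rewrite (le_trans (ler_normB _ _))// lerD2r XM//.
by rewrite ltr_pwDr// ler_norm.
Qed.

End Euclid.

Section Hausdorff.
Context {R : realType} {N : nat}.
Implicit Types X Y Z : set 'rV[R]_N.

Let adm X Y : set R := [set e | [/\ 0 < e, X `<=` onbhd Y e & Y `<=` onbhd X e]].

Let adm_lb X Y : has_lbound (adm X Y).
Proof. by exists 0 => e [/ltW]. Qed.

Let adm_neq0 X Y : compact X -> compact Y -> X !=set0 -> Y !=set0 -> adm X Y !=set0.
Proof.
move=> cX cY X0 Y0.
have [e e0 XY] := compact_onbhd cX Y0; have [d d0 YX] := compact_onbhd cY X0.
exists (Num.max e d); split; first by rewrite lt_max e0.
- by move=> x /XY /lt_le_trans; apply; rewrite le_max lexx.
- by move=> x /YX /lt_le_trans; apply; rewrite le_max lexx orbT.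
Qed.

Lemma hausdorff_distxx X : X !=set0 -> hausdorff_dist X X = 0.
Proof.
move=> X0; apply/eqP; rewrite eq_le; apply/andP; split.
  apply/ler_addgt0Pl => e e0; rewrite addr0; apply: ge_inf; first exact: adm_lb.
  by split=> // x Xx; apply/onbhdP => //; exists x => //; rewrite edistvxx.
apply: lb_le_inf => [|e [/ltW]//]; exists 1; split=> // x Xx;
  by apply/onbhdP => //; exists x => //; rewrite edistvxx.
Qed.

Lemma hausdorff_distC X Y : hausdorff_dist X Y = hausdorff_dist Y X.
Proof. by congr inf; apply/seteqP; split=> e []. Qed.

Lemma hausdorff_dist_eq0 X Y : compact X -> compact Y -> X !=set0 -> Y !=set0 ->
  hausdorff_dist X Y = 0 -> X = Y.
Proof.
move: X Y; suff sub X Y : compact X -> compact Y -> X !=set0 -> Y !=set0 ->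
    hausdorff_dist X Y = 0 -> X `<=` Y.
  move=> X Y cX cY X0 Y0 XY; apply/seteqP; split; first exact: sub.
  by apply: sub => //; rewrite hausdorff_distC.
move=> cX cY X0 Y0 XY x Xx.
have /closure_id -> : closed Y by apply: compact_closed => //; exact: norm_hausdorff.
move=> B /nbhs_ballP[e /= e0 eB].
have : hausdorff_dist X Y < e by rewrite XY.
move=> /inf_lt[]; first exact: adm_neq0.
move=> d [d0 /(_ _ Xx)/(onbhdP _ _ Y0)[y Yy xy] _] de.
by exists y; split=> //; apply/eB/edistv_ball/(lt_trans xy).
Qed.

Lemma hausdorff_dist_triangle Y X Z :
  compact X -> compact Y -> compact Z -> X !=set0 -> Y !=set0 -> Z !=set0 ->
  hausdorff_dist X Z <= hausdorff_dist X Y + hausdorff_dist Y Z.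
Proof.
move=> cX cY cZ X0 Y0 Z0.
rewrite -lerBlDr; apply: lb_le_inf; first exact: adm_neq0.
move=> a [a0 XYa YXa]; rewrite lerBlDr addrC -lerBlDr; apply: lb_le_inf; first exact: adm_neq0.
move=> b [b0 YZb ZYb]; rewrite lerBlDr addrC.
apply: ge_inf; first exact: adm_lb.
split; first exact: addr_gt0.
- move=> x /XYa/(onbhdP _ _ Y0)[y /YZb/(onbhdP _ _ Z0)[z Zz yz] xy].
  apply/onbhdP => //; exists z => //; apply: le_lt_trans (edistv_triangle y _ _) _.
  exact: ltrD.
- move=> z /ZYb/(onbhdP _ _ Y0)[y /YXa/(onbhdP _ _ X0)[x Xx yx] zy].
  apply/onbhdP => //; exists x => //; apply: le_lt_trans (edistv_triangle y _ _) _.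
  by rewrite addrC ltrD.
Qed.

Lemma is_cantor_compact X : is_cantor R (set_type X) -> compact X.
Proof.
move=> [f [g [_ cg fg gf]]].
pose h : set_type (middle_thirds R) -> 'rV[R]_N := set_val \o g.
have hE a : valL_ 0 h (set_val a) = h a := congr1 (@^~ a) (valLK 0 h).
have : {within middle_thirds R, continuous (valL_ 0 h)}.
  apply/subspace_valL_continuousP' => x; apply: continuous_comp; first exact: cg.
  exact: initial_continuous.
move=> /continuous_compact /(_ compact_middle_thirds).
suff -> : valL_ 0 h @` middle_thirds R = X by [].
apply/seteqP; split=> [_ [c /mem_set Cc <-]|x /mem_set Xx].
  by rewrite (hE (SigSub Cc)); exact: set_valP.
exists (set_val (f (SigSub Xx))); first exact: set_valP.
by rewrite hE /h /= fg.
Qed.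

Lemma is_cantor_neq0 X : is_cantor R (set_type X) -> X !=set0.
Proof.
move=> [_ [g _]]; exists (set_val (g (SigSub (mem_set (@middle_thirds0 R))))).
exact: set_valP.
Qed.

End Hausdorff.

Definition cantor_hyperspace (R : realType) (N : nat) : Type :=
  {X : set 'rV[R]_N | is_cantor R (set_type X)}.

Section CantorHyperspace.
Context (R : realType) (N : nat).
Local Notation C := (cantor_hyperspace R N).

HB.instance Definition _ := gen_eqMixin C.
HB.instance Definition _ := gen_choiceMixin C.

Definition cantor_dist (X Y : C) : R := hausdorff_dist (sval X) (sval Y).

Lemma cantor_distxx X : cantor_dist X X = 0.
Proof. by apply/hausdorff_distxx/is_cantor_neq0/(svalP X). Qed.

Lemma cantor_dist_eq0 X Y : cantor_dist X Y = 0 -> X = Y.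
Proof.
case: X Y => [X cX] [Y cY] /hausdorff_dist_eq0 XY; apply: eq_exist => /=.
by apply: XY; [exact: is_cantor_compact|exact: is_cantor_compact|
  exact: is_cantor_neq0|exact: is_cantor_neq0].
Qed.

Lemma cantor_distC X Y : cantor_dist X Y = cantor_dist Y X.
Proof. exact: hausdorff_distC. Qed.

Lemma cantor_dist_triangle Y X Z :
  cantor_dist X Z <= cantor_dist X Y + cantor_dist Y Z.
Proof.
case: X Y Z => [X cX] [Y cY] [Z cZ]; apply: hausdorff_dist_triangle;
  by [exact: is_cantor_compact|exact: is_cantor_neq0].
Qed.

HB.instance Definition _ := isMetric.Build R C
  cantor_distxx cantor_dist_eq0 cantor_distC cantor_dist_triangle.

End CantorHyperspace.

(* Main.v *)
(** Let Z consist of the Cantor sets X whose images under all functionals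
    <u, .> contain no interval.

    If x and y are distinct points of p_L X, then u = x - y lies in L, so
    <u, .> takes the same values on X and on p_L X, and a value missed strictly
    between <u, y> and <u, x> cuts p_L X into two clopen pieces that separate x
    from y. Hence p_L X is zero-dimensional.

    Z is a countable intersection, over rationals a < b and integers n, of the
    sets where each u with |u| <= n misses a value in ]a, b[; these are open
    because X and the ball of radius n are compact.

    Density needs no Baire argument: an arbitrary Cantor set is approximated by
    a finite union of tiny copies of the middle-thirds set placed on parallel
    segments. *)

Require Import Defs.
From mathcomp Require Import all_boot all_order all_algebra.
From mathcomp Require Import all_classical all_reals all_analysis.
From mathcomp Require Import borel_hierarchy.
From mathcomp Require Import lra.
Import Order.TTheory GRing.Theory Num.Theory.
Import numFieldNormedType.Exports.
Local Open Scope classical_set_scope.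
Local Open Scope ring_scope.

Set Implicit Arguments.
Unset Strict Implicit.
Unset Printing Implicit Defensive.

(** * Subsets of the line with empty interior *)

Section Gapped.
Context {R : realType}.
Implicit Types A B : set R.

Definition gapped A := forall a b, a < b -> exists2 t, a < t < b & ~ A t.

Lemma sub_gapped A B : A `<=` B -> gapped B -> gapped A.
Proof. by move=> AB gB a b /gB[t atb Bt]; exists t => // /AB. Qed.

(** A value missed by the closed set [A] comes with a whole interval missed by [A], and [B] misses
    some value of that interval. *)
Lemma gappedU A B : closed A -> gapped A -> gapped B -> gapped (A `|` B).
Proof.
move=> cA gA gB a b /gA[t /andP[at_ tb] nAt].
have : nbhs t (~` A) by apply: open_nbhs_nbhs; split=> //; exact: closed_openC.
move=> /nbhs_ballP[e /= e0 eA].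
have [|s /andP[ts sb] nBs] := gB t (Num.min b (t + e)).
  by rewrite lt_min tb ltrDl.
move: sb; rewrite lt_min => /andP[sb ste].
exists s; first by rewrite (lt_trans at_ ts).
case=> //; apply: eA; rewrite /ball/= ltr_norml; lra.
Qed.

Lemma gapped_bigcup (I : finType) (F : I -> set R) :
  (forall i, closed (F i)) -> (forall i, gapped (F i)) -> gapped (\bigcup_i F i).
Proof.
move=> cF gF.
suff H (s : seq I) : gapped (\bigcup_(i in [set` s]) F i).
  apply: sub_gapped (H (enum I)) => t [i _ Fit].
  by exists i => //=; rewrite mem_enum.
elim: s => [|i s IH].
  apply: (@sub_gapped _ set0) => [t []//|a b ab].
  by exists ((a + b) / 2) => //; apply/andP; split; lra.
apply: sub_gapped (gappedU (cF i) (gF i) IH) => t [j /=].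
by rewrite inE => /orP[/eqP-> Fit|js Fjt]; [left|right; exists j].
Qed.

(** The slope [c = 0] is allowed because a functional may vanish on the direction along which the
    small Cantor sets are laid; the image then lies in [{x}]. *)
Lemma gapped_affine (x c : R) A :
  gapped A -> gapped [set x + c * t | t in A].
Proof.
move=> gA a b ab; have [->|c0] := eqVneq c 0.
  have [ax|ax] := eqVneq ((a + b) / 2) x.
    by exists ((3 * a + b) / 4); [lra|move=> [t _]; lra].
  by exists ((a + b) / 2); [lra|move=> [t _ /eqP]; rewrite mul0r addr0 eq_sym (negbTE ax)].
have img t u : ~ A t -> u = x + c * t -> ~ [set x + c * t | t in A] u.
  by move=> nAt -> [s As /addrI/(mulfI c0)] st; apply: nAt; rewrite -st.
have [c1|c1] : c < 0 \/ 0 < c by move: c0; rewrite neq_lt => /orP.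
- have [|t /andP[bt ta] nAt] := gA ((b - x) / c) ((a - x) / c).
    by rewrite ltr_nM2r ?invr_lt0// ltrD2r.
  exists (x + c * t); last exact: img nAt _.
  move: bt ta; rewrite ltr_ndivrMr// ltr_ndivlMr// (mulrC t); lra.
- have [|t /andP[bt ta] nAt] := gA ((a - x) / c) ((b - x) / c).
    by rewrite ltr_pM2r ?invr_gt0// ltrD2r.
  exists (x + c * t); last exact: img nAt _.
  move: bt ta; rewrite ltr_pdivrMr// ltr_pdivlMr// (mulrC t); lra.
Qed.

Lemma ternary_stage_sub n : @ternary_stage R n `<=` `[0, 1].
Proof.
elim: n => [//|n IH] /= x []; move=> [y /IH /=]; rewrite !in_itv/= => y01 <-; lra.
Qed.

(** Self-similarity: an open interval inside stage [n.+1] cannot contain 1/2, so it lies in one of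
    the two thirds, and tripling that third puts it inside stage [n]. *)
Lemma ternary_stage_width n (a b : R) :
  a <= b -> `]a, b[ `<=` ternary_stage n -> b - a <= 3^-1 ^+ n.
Proof.
elim: n a b => [|n IH] a b ab sub; have [abe|ab'] := eqVneq a b;
  rewrite ?abe ?subrr ?exprn_ge0//; have {ab' }lab : a < b by rewrite lt_neqAle ab' ab.
  rewrite expr0 leNgt; apply/negP => ba.
  have H t : a < t -> t < b -> 0 <= t <= 1.
    by move=> ta tb; have := sub t; rewrite /= !in_itv/= ta tb => /(_ isT).
  (* Otherwise the midpoint of [Num.max a 1] and [b] lies in the interval but exceeds 1; the bound
     on [a] is symmetric. *)
  have b1 : b <= 1.
    rewrite leNgt; apply/negP => b1; have := H ((Num.max a 1 + b) / 2).
    by case: (leP a 1) => a1; lra.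
  have a0 : 0 <= a.
    rewrite leNgt; apply/negP => a0; have := H ((a + Num.min 0 b) / 2).
    by case: (leP 0 b) => b0; lra.
  lra.
(* The two pieces of the stage lie in [0, 1/3] and [2/3, 1]. *)
have half : ~ (a < 1/2 < b).
  move=> ahb; have [] := sub (1/2); rewrite /= ?in_itv//= => -[y /ternary_stage_sub/=];
    rewrite in_itv/= => y01; lra.
have [b2|b2] := leP b (1/2).
  have : 3 * b - 3 * a <= 3^-1 ^+ n.
    apply: IH => [|t /=]; first lra.
    rewrite in_itv/= => tab; have [] := sub (t / 3); rewrite /= ?in_itv/=; first lra.
      by move=> [y ty yt]; have -> : t = y by lra.
    by move=> [y /ternary_stage_sub/=]; rewrite in_itv/= => y01; lra.
  rewrite exprS; lra.
have : (3 * b - 2) - (3 * a - 2) <= 3^-1 ^+ n.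
  apply: IH => [|t /=]; first lra.
  rewrite in_itv/= => tab; have [] := sub ((t + 2) / 3); rewrite /= ?in_itv/=; first lra.
    by move=> [y /ternary_stage_sub/=]; rewrite in_itv/= => y01; lra.
  by move=> [y ty yt]; have -> : t = y by lra.
rewrite exprS; lra.
Qed.

Lemma gapped_middle_thirds : gapped (middle_thirds R).
Proof.
move=> a b ab; apply: contrapT => nt.
have sub n : b - a <= 3^-1 ^+ n.
  apply: ternary_stage_width => [|t]; first exact: ltW.
  rewrite /= in_itv/= => atb; apply: contrapT => tn; apply: nt; exists t => //.
  by move=> /(_ n I).
have : (fun n : nat => (3^-1 : R) ^+ n) @ \oo --> 0.
  by apply: cvg_expr; rewrite ger0_norm; lra.
move=> /cvgrPdist_lt/(_ (b - a)); rewrite subr_gt0 => /(_ ab)[n _ /(_ n (leqnn n))] /=.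
by rewrite sub0r normrN ger0_norm ?exprn_ge0// ltNge sub.
Qed.

End Gapped.

(** * Separation and compactness of subspaces *)

Section SetType.
Context {T : topologicalType}.

Lemma set_type_hausdorff (A : set T) :
  hausdorff_space T -> hausdorff_space (set_type A).
Proof.
move=> hT x y xy; apply: val_inj; apply: hT => U V nU nV.
have [z [Uz Vz]] := xy _ _ (initial_continuous nU) (initial_continuous nV).
by exists (set_val z).
Qed.

Lemma set_type_compact (A : set T) : compact A -> compact [set: set_type A].
Proof.
move=> /compact_near_coveringP/near_covering_withinP cA.
apply/compact_near_coveringP => I F P FF Pnear.
(* Quantifying over membership proofs turns a property of points of the subspace into one of points
   of [T]. *)
have /cA : forall x, A x -> \forall x' \near x & i \near F,
    A x' -> forall xA : x' \in A, P i (SigSub xA).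
  move=> x Ax; have [[U V] /= [nU FV] UV] := Pnear (SigSub (mem_set Ax)) Logic.I.
  have [_ [[W oW <-] /= Wx WU]] := nU.
  exists (W, V); first by split=> //; exact: open_nbhs_nbhs.
  by move=> [x' i] /= [Wx' Vi] _ xA; apply: (UV (_, _)); split=> //; exact: WU.
apply: filterS => i PA [x xA] _; exact: (PA _ (set_mem xA)).
Qed.

End SetType.

(** * Linear functionals and the dimension of projections *)

Section Dot.
Context {R : realType} {N : nat}.
Implicit Types (u x : 'rV[R]_N) (X : set 'rV[R]_N) (L : {vspace 'rV[R]_N}).

Lemma dotv_continuous2 : continuous (fun ux : 'rV[R]_N * 'rV[R]_N => dotv ux.1 ux.2).
Proof.
rewrite /dotv; apply: continuous_big => [|i _ [u x]]; first exact: add_continuous.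
have cf : {for (u, x), continuous (fun w : 'rV[R]_N * 'rV[R]_N => w.1 0 i)}.
  by apply: (@continuous_comp _ _ _ fst (fun v : 'rV[R]_N => v 0 i));
    [exact: cvg_fst|exact: coord_continuous].
have cg : {for (u, x), continuous (fun w : 'rV[R]_N * 'rV[R]_N => w.2 0 i)}.
  by apply: (@continuous_comp _ _ _ snd (fun v : 'rV[R]_N => v 0 i));
    [exact: cvg_snd|exact: coord_continuous].
exact: (continuousM cf cg).
Qed.

Lemma dotv_continuous u : continuous (dotv u).
Proof.
move=> x.
exact: (cvg_comp2 (h := dotv) (cvg_cst u) cvg_id (@dotv_continuous2 (u, x))).
Qed.

Lemma ortho_proj_continuous L : continuous (ortho_proj L).
Proof.
have -> : ortho_proj L = (fun x => \sum_(j < N) x 0 j *: ortho_proj L (delta_mx 0 j)) :> (_ -> _).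
  apply/funext => x; rewrite {1}(row_sum_delta x) linear_sum.
  by apply: eq_bigr => j _; rewrite linearZ.
apply: continuous_big => [|j _ x]; first exact: add_continuous.
by apply: continuousZr_tmp; exact: coord_continuous.
Qed.

Lemma dotv_ortho_proj L u x : u \in L -> dotv u (ortho_proj L x) = dotv u x.
Proof.
move=> /(@ortho_projP _ _ L x); rewrite dotvC linearBr/= => /eqP.
by rewrite subr_eq0 => /eqP.
Qed.

(** The cuts only separate pairs of points by clopen sets; in a compact Hausdorff space this already
    yields a clopen base, as [has_dim0P] requires. *)
Lemma gapped_has_dim0 X L : compact X -> X !=set0 ->
  (forall u, gapped [set dotv u x | x in X]) ->
  has_dim (set_type (ortho_proj L @` X : set 'rV[R]_N)) 0.
Proof.
move=> cX [x0 Xx0] gX; pose Y : set 'rV[R]_N := ortho_proj L @` X.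
have cY : compact Y.
  by apply: continuous_compact cX; apply: continuous_subspaceT; exact: ortho_proj_continuous.
have zY : zero_dimensional (set_type Y).
  move=> x y xy.
  have [x' Xx' px] : Y (set_val x) := set_valP x; have [y' Xy' py] : Y (set_val y) := set_valP y.
  pose u := set_val x - set_val y.
  have uL : u \in L by rewrite /u -px -py; apply: memvB; exact: ortho_proj_mem.
  have : dotv u (set_val y) < dotv u (set_val x).
    rewrite -subr_gt0 -[X in 0 < X](linearBr dotv u); apply: dotv_gt0; rewrite subr_eq0.
    by apply: contra xy => /eqP/val_inj->.
  move=> /(gX u)[t /andP[yt tx] nt].
  have cd : continuous (fun z : set_type Y => dotv u (set_val z)).
    move=> z; apply: continuous_comp; first exact: initial_continuous.
    exact: dotv_continuous.
  have tE (z : set_type Y) : dotv u (set_val z) != t.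
    apply/eqP => zt; apply: nt; have [z' Xz' pz] : Y (set_val z) := set_valP z.
    by exists z' => //; rewrite -zt -pz dotv_ortho_proj.
  exists [set z | t < dotv u (set_val z)]; split=> //; last first.
    by apply/negP; rewrite -leNgt ltW.
  split.
    apply: (@open_comp _ _ (fun z : set_type Y => dotv u (set_val z)) [set r | t < r]).
      by move=> z _; exact: cd.
    exact: open_gt.
  (* As [t] is never attained, the strict and the weak upper level sets coincide, so the open one is
     closed. *)
  have -> : [set z : set_type Y | t < dotv u (set_val z)] = [set z | t <= dotv u (set_val z)].
    by apply/seteqP; split=> z /=; rewrite le_eqVlt eq_sym (negbTE (tE z)).
  apply: (@closed_comp _ _ (fun z : set_type Y => dotv u (set_val z)) [set r | t <= r]).
    by move=> z _; exact: cd.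
  exact: closed_ge.
apply/has_dim0P; split.
  by exists (SigSub (mem_set (imageP (ortho_proj L) Xx0))).
move=> x W oW Wx.
have : nbhs x W by exact: open_nbhs_nbhs.
have hY : hausdorff_space (set_type Y).
  by apply: set_type_hausdorff; exact: norm_hausdorff.
move=> /(zero_dimensional_cvg hY zY (set_type_compact cY))[V [Vx clV] VW].
by exists V.
Qed.

(** A missed value is stable under perturbing both the functional and the set: continuity gives this
    locally in [x], and compactness of [X] makes it uniform. *)
Lemma near_dotv_neq X u t : compact X -> (forall x, X x -> dotv u x != t) ->
  \forall v \near u & e \near 0^'+,
    forall x y, X x -> edistv x y < e -> dotv v y != t.
Proof.
move=> /compact_near_coveringP cX ut.
have /cX : forall x, X x -> \forall x' \near x & ve \near filter_prod (nbhs u) (0^'+),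
    forall y, edistv x' y < ve.2 -> dotv ve.1 y != t.
  move=> x /ut uxt.
  have : nbhs (u, x) [set w : 'rV[R]_N * 'rV[R]_N | dotv w.1 w.2 != t].
    have nt : nbhs (dotv u x) [set r | r != t].
      by apply: open_nbhs_nbhs; split=> //; exact: open_neq.
    exact: (@dotv_continuous2 (u, x) _ nt).
  move=> [[U V] /= [nU /nbhs_ballP[d /= d0 dV]] UV].
  exists (ball x (d / 2), U `*` [set e | e < d / 2]) => /=.
    split; first by apply: nbhsx_ballx; rewrite divr_gt0.
    exists (U, [set e | e < d / 2]) => //; split=> //.
    by apply: nbhs_right_lt; rewrite divr_gt0.
  move=> [x' [v e]] /= [xx' [Uv ed]] y x'y.
  apply: (UV (v, y)); split=> //; apply: dV.
  rewrite [d]splitr; apply: ball_triangle xx' _.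
  exact/edistv_ball/(lt_trans x'y).
apply: filterS => -[v e] /= H x y Xx; exact: H.
Qed.

Lemma compact_norm_le (n : R) : compact [set u : 'rV[R]_N | `|u| <= n].
Proof.
apply: bounded_closed_compact.
  by exists n; split; [exact: num_real|move=> m nm u /= /le_trans; apply; exact: ltW].
apply: (@closed_comp _ _ (fun u : 'rV[R]_N => `|u|) [set r | r <= n]) => [u _|].
  exact: norm_continuous.
exact: closed_le.
Qed.

End Dot.

(** * The $G_\delta$ property *)

Section Hyperspace.
Context {R : realType} {N : nat}.
Local Notation C := (cantor_hyperspace R N).
Implicit Types (u : 'rV[R]_N) (X : C).

(** This is the half of Hausdorff closeness that openness uses: nothing of [Y] strays far from
    [X]. *)
Lemma cantor_ballP X Y e : ball X e Y ->
  forall y, sval Y y -> exists2 x, sval X x & edistv x y < e.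
Proof.
have X0 := is_cantor_neq0 (svalP X); have Y0 := is_cantor_neq0 (svalP Y).
rewrite ballEmdist /= => /inf_lt[|d [d0 _ YX] de y /YX/(onbhdP _ _ X0)[x Xx yx]].
  have [d1 d10 XY] := compact_onbhd (is_cantor_compact (svalP X)) Y0.
  have [d2 d20 YX] := compact_onbhd (is_cantor_compact (svalP Y)) X0.
  exists (Num.max d1 d2); split; first by rewrite lt_max d10.
  - by move=> x /XY /lt_le_trans; apply; rewrite le_max lexx.
  - by move=> x /YX /lt_le_trans; apply; rewrite le_max lexx orbT.
by exists x => //; rewrite edistvC (lt_trans yx).
Qed.

(** Near each [u] one value [t] stays missed, with a radius depending on [u]; compactness of the
    ball of radius [n] provides one radius for all [u], while [t] may still vary with [u]. *)
Lemma open_gap_between (a b n : R) :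
  open [set X : C | forall u, `|u| <= n ->
    exists2 t, a < t < b & ~ [set dotv u x | x in sval X] t].
Proof.
rewrite openE => X HX.
have cX := is_cantor_compact (svalP X).
have /compact_near_coveringP cB := @compact_norm_le R N n.
have /cB [e /= e0 He] : forall u : 'rV[R]_N, `|u| <= n ->
    \forall v \near u & e \near 0^'+, exists2 t, a < t < b &
      forall x y, sval X x -> edistv x y < e -> dotv v y != t.
  move=> u /HX[t atb nt].
  have ut x : sval X x -> dotv u x != t by move=> Xx; apply/eqP => ?; apply: nt; exists x.
  by apply: filterS (near_dotv_neq cX ut) => -[v e] /= H; exists t.
have {}He := He (e / 2).
apply/nbhs_ballP; exists (e / 2) => /=; first by rewrite divr_gt0.
move=> Y /cantor_ballP XY u un.
have [||t atb Ht] := He _ _ u un; rewrite ?divr_gt0//.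
  by rewrite /= sub0r normrN ger0_norm ?divr_ge0 ?(ltW e0)// ltr_pdivrMr// ltr_pMr// ltr1n.
exists t => // -[y Yy yt]; have [x Xx xy] := XY y Yy.
by have := Ht x y Xx xy; rewrite yt eqxx.
Qed.

Definition gapped_cantor : set C :=
  [set X | forall u, gapped [set dotv u x | x in sval X]].

Lemma Gdelta_gapped_cantor : Gdelta gapped_cantor.
Proof.
(* Keeping [a < b] as a premise inside [U] lets all triples serve as indices; a badly ordered pair
   gives the whole space. *)
pose U (p : rat * rat * nat) : set C :=
  [set X | ratr p.1.1 < ratr p.1.2 :> R -> forall u, `|u| <= p.2%:R ->
    exists2 t, ratr p.1.1 < t < ratr p.1.2 & ~ [set dotv u x | x in sval X] t].
have oU p : open (U p).
  have [ab|ab] := boolP (ratr p.1.1 < ratr p.1.2 :> R); last first.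
    have -> : U p = setT by apply/seteqP; split=> // X _ /(negP ab).
    exact: openT.
  have := @open_gap_between (ratr p.1.1) (ratr p.1.2) p.2%:R.
  by congr open; apply/seteqP; split=> [X HX _|X /(_ ab)].
exists (fun i => if unpickle i is Some p then U p else setT).
  by move=> i; case: unpickle => [p|]; [exact: oU|exact: openT].
apply/seteqP; split=> [X gX i _|X HX u a b ab].
  by case: unpickle => // p ab u _; exact: gX.
(* Rationals [q < q'] are nested inside []a, b[], and the integer bound is chosen just above the
   norm of [u]. *)
have [q' /itvP q'E] := rat_in_itvoo ab.
have [q /itvP qE] : exists q : rat, ratr q \in `]a, ratr q'[ by apply: rat_in_itvoo; rewrite q'E.
have /(_ I) := HX (pickle (q, q', (Num.truncn `|u|).+1)).
rewrite pickleK => /(_ _ u)[||t /andP[qt tq'] nt] /=; rewrite ?qE//.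
  by rewrite ltW// truncnS_gt.
exists t => //; apply/andP; split.
  by apply: lt_trans qt; rewrite qE.
by apply: (lt_trans tq'); rewrite q'E.
Qed.

End Hyperspace.

(** * Approximation by Cantor sets with gapped images *)

(** The inverse is continuous because [f] sends closed sets, which are compact here, to compact and
    hence closed sets. *)
Lemma homeomorphic_range (S T : topologicalType) (f : S -> T) :
  compact [set: S] -> hausdorff_space T -> continuous f -> injective f ->
  homeomorphic (set_type (range f)) S.
Proof.
move=> cS hT cf injf.
have /choice[g fg] : forall y : set_type (range f), exists x, f x = set_val y.
  by move=> y; have [x _ <-] : range f (set_val y) := set_valP y; exists x.
pose f' x : set_type (range f) := SigSub (mem_set (imageT f x)).
exists g, f'; split.
- apply/continuous_closedP => A cA.
  have -> : g @^-1` A = set_val @^-1` (f @` A).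
    apply/seteqP; split=> y /= => [Ay|[x Ax xy]]; first by exists (g y).
    by rewrite (_ : g y = x)//; apply: injf; rewrite fg.
  apply: closed_comp => [y _|]; first exact: initial_continuous.
  apply: compact_closed => //; apply: continuous_compact.
    exact: continuous_subspaceT.
  exact: subclosed_compact cS _.
- exact: continuous_comp_initial.
- by move=> y; apply: val_inj; rewrite /= fg.
- by move=> x; apply: injf; rewrite fg.
Qed.

(** Cut the line at a missed value [t i] in each cell of a grid of mesh 1/k, and let [J c] record
    which cuts lie below [c]. No cut belongs to the Cantor set, so [J] is locally constant. *)
Lemma middle_thirds_pieces (R : realType) (e : R) : 0 < e ->
  exists (I : finType) (J : set_type (middle_thirds R) -> I),
    (forall c, \forall c' \near c, J c' = J c) /\
    (forall c c', J c = J c' -> `|set_val c - set_val c'| < e).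
Proof.
move=> e0; pose k := (Num.truncn (2 / e)).+1.
have k0 : 0 < k%:R :> R by rewrite ltr0n.
have ke : 2 < e * k%:R by rewrite mulrC -ltr_pdivrMr// truncnS_gt.
have /choice[t tP] : forall i : 'I_k, exists t : R,
    i%:R < t * k%:R < i%:R + 1 /\ ~ middle_thirds R t.
  move=> i; have [|t /andP[it ti] nt] := @gapped_middle_thirds R (i%:R / k%:R) ((i%:R + 1) / k%:R).
    by rewrite ltr_pM2r ?invr_gt0// ltrDl.
  exists t; split=> //; move: it ti; rewrite ltr_pdivrMr// ltr_pdivlMr// => -> ->.
  by [].
pose J (c : set_type (middle_thirds R)) := [ffun i => t i < set_val c].
exists {ffun 'I_k -> bool}, J; split=> [c|].
  have : \forall c' \near c, forall i, (t i < set_val c') = (t i < set_val c).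
    apply: (@filter_forall _ _ (fun i c' => (t i < set_val c') = (t i < set_val c)) (nbhs c)).
    move=> i; have [tc|] := ltP (t i) (set_val c).
      exact: (@initial_continuous _ _ set_val c _ (open_nbhs_nbhs (conj (@open_gt R (t i)) tc))).
    rewrite le_eqVlt => /orP[/eqP ct|ct].
      by case: (tP i) => _ []; rewrite -ct; exact: set_valP.
    have : \forall c' \near c, set_val c' < t i.
      exact: (@initial_continuous _ _ set_val c _ (lt_nbhsl ct)).
    by apply: filterS => c' ct'; apply/negbTE; rewrite -leNgt ltW.
  by apply: filterS => c' H; apply/ffunP => i; rewrite !ffunE.
have key c c' : J c = J c' -> set_val c' - set_val c < e.
  move=> Jcc'; rewrite ltNge; apply/negP => ecc.
  have c01 : 0 <= set_val c <= 1.
    have : middle_thirds R (set_val c) := set_valP c.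
    by move=> /(_ 0%N Logic.I); rewrite /= in_itv.
  have c'01 : 0 <= set_val c' <= 1.
    have : middle_thirds R (set_val c') := set_valP c'.
    by move=> /(_ 0%N Logic.I); rewrite /= in_itv.
  have ck0 : 0 <= set_val c * k%:R by rewrite mulr_ge0 ?ler0n//; lra.
  have ckk : set_val c * k%:R + 2 < set_val c' * k%:R.
    rewrite -ltrBrDl -mulrBl (lt_le_trans ke)// ler_wpM2r//; exact: ltW.
  have c'k : set_val c' * k%:R <= k%:R by rewrite ler_piMl ?ler0n//; lra.
  have /andP[m1 m2] := truncn_itv ck0; set m := Num.truncn _ in m1 m2.
  have mk : (m.+1 < k)%N by rewrite -(ltr_nat R) -natr1; lra.
  have [/= /andP[l r] _] := tP (Ordinal mk).
  move/ffunP: Jcc' => /(_ (Ordinal mk)); rewrite !ffunE.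
  have -> : t (Ordinal mk) < set_val c'.
    by rewrite -(ltr_pM2r k0); move: r; rewrite -natr1; lra.
  by rewrite ltNge -(ler_pM2r k0) (ltW (lt_trans m2 l)).
move=> c c' Jcc'; rewrite ltr_norml ltrNl opprB.
by rewrite (key c c')// (key c' c).
Qed.

Lemma nbhs_edistv (R : realType) (N : nat) (x : 'rV[R]_N) (e : R) :
  0 < e -> nbhs x [set y | edistv x y < e].
Proof.
move=> e0; have s0 : 0 < Num.sqrt N%:R + 1 :> R by rewrite ltr_wpDl ?sqrtr_ge0.
apply/nbhs_ballP; exists (e / (Num.sqrt N%:R + 1)) => /=; first by rewrite divr_gt0.
move=> y; rewrite -ball_normE /= ltr_pdivlMr// => xye.
apply: le_lt_trans (edistv_le_norm _ _) (le_lt_trans _ xye).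
by rewrite sqrtrM ?ler0n// sqrtr_sqr normr_id mulrC ler_wpM2l// lerDl.
Qed.

Lemma edistv_delta (R : realType) (N : nat) (x : 'rV[R]_N) (a : R) (i : 'I_N) :
  edistv x (x + a *: delta_mx 0 i) = `|a|.
Proof.
rewrite edistvC /edistv addrC addKr -sqrtr_sqr; congr Num.sqrt.
rewrite /dotv (bigD1 i)//= !mxE !eqxx mulr1 expr2 big1 ?addr0// => j ji.
by rewrite !mxE (negbTE ji) andbF mulr0 mul0r.
Qed.

Lemma set_type_unif_continuous (R : realType) (N : nat) (K : set R)
    (G : set_type K -> 'rV[R]_N) (e : R) :
  compact K -> continuous G -> 0 < e ->
  exists2 d, 0 < d &
    forall c c', `|set_val c - set_val c'| < d -> edistv (G c) (G c') < e.
Proof.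
move=> /set_type_compact/compact_near_coveringP cK cG e0.
have e20 : 0 < e / 2 by rewrite divr_gt0.
have /cK : forall c, [set: set_type K] c -> \forall c1 \near c & d \near 0^'+,
    forall c', `|set_val c1 - set_val c'| < d -> edistv (G c1) (G c') < e.
  move=> c _.
  have [_ [[V oV <-] /= Vc VW]] := cG c _ (nbhs_edistv (G c) e20).
  have /nbhs_ballP[d /= d0 dV] : nbhs (set_val c) V by exact: open_nbhs_nbhs.
  have d20 : 0 < d / 2 by rewrite divr_gt0.
  exists (set_val @^-1` ball (set_val c) (d / 2), [set r | r < d / 2]) => /=.
    split; last exact: nbhs_right_lt.
    exact: (@initial_continuous _ _ set_val c _ (nbhsx_ballx _ _ d20)).
  move=> [c1 r] /= [cc1 rd] c' c1c'.
  rewrite [e]splitr; apply: le_lt_trans (edistv_triangle (G c) _ _) _.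
  apply: ltrD; last first.
    apply: VW; apply: dV; rewrite [d]splitr; apply: ball_triangle cc1 _.
    exact: lt_trans rd.
  rewrite edistvC; apply: VW; apply: dV; apply: le_ball cc1.
  by rewrite ler_pdivrMr// ler_pMr// ler1n.
move=> Hnear.
have [d [d0 Hd]] : exists d, 0 < d /\ [set: set_type K] `<=` (fun c1 =>
    forall c', `|set_val c1 - set_val c'| < d -> edistv (G c1) (G c') < e).
  near (0 : R)^'+ => d; exists d; split; [by []|].
  by near: d.
by exists d => // c c'; exact: Hd.
Unshelve. all: by end_near. Qed.

(* With c in the middle-thirds set, parametrizing X by G, and J the index of its
   clopen piece, the approximation is phi c = h (J c) + r c e_i0: the pieces are
   anchored at the finitely many points h i, and r is smaller than every nonzero
   gap between their i0-th coordinates, which makes phi injective. *)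
Lemma dense_gapped_cantor (R : realType) (N : nat) : (1 <= N)%N ->
  dense (@gapped_cantor R N).
Proof.
move=> N0 O [X OX] oO.
have /nbhs_ballP[e /= e0 eO] : nbhs X O by exact: open_nbhs_nbhs.
suff [Y [XY gY]] : exists Y, ball X e Y /\ gapped_cantor Y.
  by exists Y; split=> //; exact: eO.
have e40 : 0 < e / 4 by rewrite divr_gt0.
pose i0 : 'I_N := Ordinal N0.
have [f [g [_ cg fg gf]]] := svalP X.
pose G c := set_val (g c).
have cG : continuous G.
  by move=> c; apply: continuous_comp; [exact: cg|exact: initial_continuous].
have [d d0 Gd] := set_type_unif_continuous (@compact_middle_thirds R) cG e40.
have [I [J [J_loc J_small]]] := middle_thirds_pieces d0.
have /choice[h hP] : forall i, exists v, forall c, J c = i -> edistv (G c) v < e / 4.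
  move=> i; have [[c ci]|nc] := pselect (exists c, J c = i).
    by exists (G c) => c' c'i; apply/Gd/J_small; rewrite ci.
  by exists 0 => c ci; case: nc; exists c.
have [r [r0 re rh]] : exists r : R, [/\ 0 < r, r < e / 4 &
    forall ij : I * I, h ij.1 0 i0 != h ij.2 0 i0 -> r < `|h ij.1 0 i0 - h ij.2 0 i0|].
  near (0 : R)^'+ => r; exists r; split; [by []|by near: r; exact: nbhs_right_lt|].
  near: r; apply: filter_forall => ij.
  have [->|hij] := eqVneq (h ij.1 0 i0) (h ij.2 0 i0); first exact: nearW.
  have : 0 < `|h ij.1 0 i0 - h ij.2 0 i0| by rewrite normr_gt0 subr_eq0.
  by move=> /nbhs_right_lt; apply: filterS.
have K01 (c : set_type (middle_thirds R)) : 0 <= set_val c <= 1.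
  have : middle_thirds R (set_val c) := set_valP c.
  by move=> /(_ 0%N Logic.I); rewrite /= in_itv.
pose phi c := h (J c) + (r * set_val c) *: delta_mx 0 i0.
have cphi : continuous phi.
  move=> c.
  have hJ : {for c, continuous (h \o J)}.
    apply: (@cvg_near_cst _ _ (h (J c)) (h \o J) (nbhs c)).
    by apply: filterS (J_loc c) => c' /= ->.
  have rc : {for c, continuous (fun c => (r * set_val c) *: delta_mx 0 i0 : 'rV[R]_N)}.
    apply: continuousZr_tmp; apply: continuousM; first exact: cst_continuous.
    exact: initial_continuous.
  exact: (continuousD hJ rc).
have phii c : phi c 0 i0 = h (J c) 0 i0 + r * set_val c.
  by rewrite /phi !mxE !eqxx mulr1.
have injphi : injective phi.
  move=> c c' cc'; apply: val_inj.
  have := congr1 (fun v : 'rV_N => v 0 i0) cc'; rewrite !phii => E.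
  have [hcc'|hcc'] := eqVneq (h (J c) 0 i0) (h (J c') 0 i0).
    by move: E; rewrite hcc' => /addrI/(mulfI (lt0r_neq0 r0)).
  have := rh (J c, J c') hcc'; rewrite /= ltNge => /negP[].
  have -> : h (J c) 0 i0 - h (J c') 0 i0 = r * (set_val c' - set_val c) by lra.
  rewrite normrM (gtr0_norm r0) ler_piMr ?(ltW r0)// ler_norml.
  by have := K01 c; have := K01 c'; lra.
have Yc : is_cantor R (set_type (range phi)).
  apply: homeomorphic_range cphi injphi; last exact: norm_hausdorff.
  exact/set_type_compact/compact_middle_thirds.
have Gphi c : edistv (G c) (phi c) < e / 2.
  apply: le_lt_trans (edistv_triangle (h (J c)) _ _) _.
  have := hP (J c) c erefl; rewrite edistv_delta normrM (gtr0_norm r0).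
  have : r * `|set_val c| <= r.
    by rewrite ler_piMr ?(ltW r0)// ler_norml; have := K01 c; lra.
  lra.
exists (exist _ (range phi) Yc); split.
  rewrite ballEmdist /=; apply: (@le_lt_trans _ _ (e / 2)); last lra.
  apply: ge_inf; first by exists 0 => a [/ltW].
  split=> [|x Xx|_ [c _ <-]]; first lra.
  - apply/onbhdP; first exact: (is_cantor_neq0 Yc).
    pose c := f (SigSub (mem_set Xx)); exists (phi c); first exact: imageT.
    by have := Gphi c; rewrite /G fg.
  - apply/onbhdP; first exact: (is_cantor_neq0 (svalP X)).
    by exists (G c); [exact: set_valP|rewrite edistvC].
move=> u; pose F i := [set dotv u (h i) + (r * u 0 i0) * t | t in middle_thirds R].
apply: (@sub_gapped _ _ (\bigcup_i F i)); last first.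
  apply: gapped_bigcup => i; last exact/gapped_affine/gapped_middle_thirds.
  apply: compact_closed; first exact: norm_hausdorff.
  apply: continuous_compact (@compact_middle_thirds R).
  apply: continuous_subspaceT => t; apply: cvgD; first exact: cvg_cst.
  by apply: cvgMr; exact: cvg_id.
move=> _ [_ [c _ <-] <-]; exists (J c) => //; exists (set_val c); first exact: set_valP.
rewrite /phi linearDr/= linearZr/=; congr (_ + _).
rewrite /dotv (bigD1 i0)//= !mxE !eqxx big1 => [|j ji].
  by rewrite /GRing.scale/=; lra.
by rewrite !mxE (negbTE ji) andbF mulr0.
Unshelve. all: by end_near. Qed.

Theorem mainTheorem6 (R : realType) (N : nat) (hN : (1 <= N)%N) :
  exists Z : set (cantor_hyperspace R N),
    [/\ dense Z, Gdelta Z &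
      forall X : cantor_hyperspace R N, Z X ->
        forall L : {vspace 'rV[R]_N},
          has_dim (set_type (ortho_proj L @` sval X : set 'rV[R]_N)) 0].
Proof.
exists (@gapped_cantor R N); split=> [||X gX L].
- exact: dense_gapped_cantor.
- exact: Gdelta_gapped_cantor.
- by apply: gapped_has_dim0 gX; [exact: is_cantor_compact (svalP X)|exact: is_cantor_neq0 (svalP X)].
Qed.
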